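(* Let $K$ be a field, let $H$ be a subgroup of $K^\times$, and let $\varphi:K\to F$ be the canonical quotient map to the quotient hyperfield $F=K/H$. Let $A$ be an $m\times n$ matrix over $F$ with $m\ge n$. Then the following are equivalent: (1) $r_{\mathrm{mat}}(\varphi^{-1}(A))=n$; (2) $r_{\varphi\text{-}\mathrm{mat}}(A)=n$; (3) $r_{\mathrm{col}}(A)=n$; (4) $r_{\mathrm{mat}}(A)=n$.
   Context: A tract is a multiplicatively written commutative monoid $F$ with an absorbing element $0$ such that $F^\times=F\setminus\{0\}$ is a group, together with a null set $N_F\subseteq\mathbb{N}[F^\times]$ containing the empty sum, containing $1+\epsilon$ for a unique $\epsilon\in F^\times$, and closed under $F^\times$-scaling (formal sums are read with zero terms discarded). A field $K$ is a tract whose null set consists of formal sums summing to $0$ in $K$. The quotient hyperfield $F=K/H$ is the monoid $(K^\times/H)\cup\{0\}$ with null set consisting of the formal sums $\sum_{i=1}^k x_i$ of cosets $x_i$ for which there exist representatives $\tilde x_i\in x_i$ with $\sum_i\tilde x_i=0$ in $K$; the quotient map $\varphi:K\to F$ is a tract homomorphism, applied entrywise to matrices. $X,Y\in F^n$ are orthogonal if $\sum_iX_iY_i\in N_F$. Vectors $X_1,\dots,X_k\in F^n$ are linearly dependent if there are $c_i\in F$, not all zero, with $\sum_ic_iX_i\in(N_F)^n$ coordinatewise, and linearly independent otherwise. An $F$-matroid $M$ of rank $r$ on $[n]$ is a rank-$r$ matroid $\underline{M}$ on $[n]$ with subsets $\mathcal{C}(M),\mathcal{C}^*(M)\subseteq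 F^n$ ($F$-circuits, $F$-cocircuits), closed under $F^\times$-scaling, whose supports are circuits (resp. cocircuits) of $\underline{M}$, each circuit (resp. cocircuit) being the support of an $F$-circuit (resp. $F$-cocircuit) unique up to scaling, and every $F$-circuit orthogonal to every $F$-cocircuit. Covectors of $M$: elements of $F^n$ orthogonal to all $F$-circuits. The push-forward $\varphi_*(M')$ of a $K$-matroid $M'$ has the same underlying matroid and $F$-circuits (resp. cocircuits) $c\,\varphi(X)$ with $X$ a circuit (resp. cocircuit) of $M'$ and $c\in F^\times$. For a matrix $B$ over a tract: $r_{\mathrm{col}}(B)$ is the maximal number of linearly independent columns; $r_{\mathrm{mat}}(B)$ is the minimal rank of a matroid over that tract on the column set having all rows of $B$ as covectors (over a field this is the usual rank). $r_{\varphi\text{-}\mathrm{mat}}(A)$ is the minimal rank of a $K$-matroid $M'$ on $[n]$ with every row of $A$ a covector of $\varphi_*(M')$; $r_{\mathrm{mat}}(\varphi^{-1}(A))$ is the minimal rank of a matrix $A'$ over $K$ with $\varphi(A')=A$. *)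

(* Defs.v *)
From mathcomp Require Import all_boot all_order all_algebra.
From mathcomp Require Import boolp.

Set Implicit Arguments.
Unset Strict Implicit.
Unset Printing Implicit Defensive.

Import GRing.Theory.

Lemma asbool_ex (P : nat -> Prop) : (exists k, P k) -> exists k, `[< P k >].
Proof. by case=> k Pk; exists k; apply/asboolP. Qed.

Definition least (P : nat -> Prop) (exP : exists k, P k) : nat :=
  ex_minn (asbool_ex exP).

(* An element of N[F^x] is encoded by a sequence of elements of F, read as a
   formal sum: the order of the terms and the terms equal to 0 are irrelevant,
   which is what null_perm and null_cons0 say. *)
Record tract := Tract {
  tract_sort :> choiceType;
  tzero : tract_sort;
  tone : tract_sort;
  tmul : tract_sort -> tract_sort -> tract_sort;
  tmulA : associative tmul;
  tmulC : commutative tmul;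
  tmul1 : left_id tone tmul;
  tmul0 : left_zero tzero tmul;
  tone_neq0 : tone <> tzero;
  tmulV : forall x, x <> tzero -> exists y, tmul x y = tone;
  null : seq tract_sort -> Prop;
  null_perm : forall s t, perm_eq s t -> null s -> null t;
  null_cons0 : forall s, null (tzero :: s) <-> null s;
  null_nil : null [::];
  null_eps : exists! e, e <> tzero /\ null [:: tone; e];
  null_scale : forall c s, c <> tzero -> null s -> null [seq tmul c x | x <- s]
}.

Arguments tzero {_}.
Arguments tone {_}.
Arguments tmul {_}.
Arguments null {_}.

Record tract_hom (F G : tract) := TractHom {
  thom_fun :> F -> G;
  thom0 : thom_fun tzero = tzero;
  thom1 : thom_fun tone = tone;
  thomM : {morph thom_fun : x y / tmul x y};
  thom_null : forall s, null s -> null [seq thom_fun x | x <- s]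
}.

Section Vectors.
Variable F : tract.

Definition tscale (c : F) (n : nat) (X : 'rV[F]_n) : 'rV[F]_n :=
  map_mx (tmul c) X.

Definition vsupp (n : nat) (X : 'rV[F]_n) : {set 'I_n} :=
  [set i | X ord0 i != tzero].

Definition orthogonal (n : nat) (X Y : 'rV[F]_n) : Prop :=
  null [seq tmul (X ord0 i) (Y ord0 i) | i : 'I_n].

Definition lin_dependent (m : nat) (I : finType) (X : I -> 'cV[F]_m) : Prop :=
  exists2 c : I -> F, exists i, c i <> tzero
    & forall j : 'I_m, null [seq tmul (c i) (X i j ord0) | i : I].

End Vectors.

Record matroid (E : finType) := Matroid {
  bases : {set {set E}};
  bases_neq0 : bases != set0;
  basis_exchange : forall B1 B2 x, B1 \in bases -> B2 \in bases ->
    x \in B1 :\: B2 -> exists2 y, y \in B2 :\: B1 & (y |: (B1 :\ x)) \in bases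
}.

(* When Bs is the family of bases of a matroid, these are its circuits. *)
Definition minimal_dependent (E : finType) (Bs : {set {set E}}) :
    {set {set E}} :=
  [set C | minset (fun X : {set E} => [forall B in Bs, ~~ (X \subset B)]) C].

Section MatroidNotions.
Variables (E : finType) (M : matroid E).

(* All bases have the same cardinality. *)
Definition matroid_rank : nat := \max_(B in bases M) #|B|.

Definition circuits : {set {set E}} := minimal_dependent (bases M).

(* The cocircuits are the circuits of the dual matroid, whose bases are the
   complements of the bases of M. *)
Definition cocircuits : {set {set E}} :=
  minimal_dependent [set ~: B | B in bases M].

End MatroidNotions.

Record signature (F : tract) (n : nat) (D : {set {set 'I_n}})
    (S : 'rV[F]_n -> Prop) : Prop := Signature {
  sig_scale : forall c X, c <> tzero -> S X -> S (tscale c X);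
  sig_supp : forall X, S X -> vsupp X \in D;
  sig_ex : forall C, C \in D -> exists2 X, S X & vsupp X = C;
  sig_uniq : forall X Y, S X -> S Y -> vsupp X = vsupp Y ->
    exists2 c, c <> tzero & Y = tscale c X
}.

Record tmatroid (F : tract) (n : nat) := TMatroid {
  underlying : matroid 'I_n;
  tcircuit : 'rV[F]_n -> Prop;
  tcocircuit : 'rV[F]_n -> Prop;
  tcircuitP : signature (circuits underlying) tcircuit;
  tcocircuitP : signature (cocircuits underlying) tcocircuit;
  tcircuit_orthogonal : forall X Y,
    tcircuit X -> tcocircuit Y -> orthogonal X Y
}.

Definition trank (F : tract) (n : nat) (M : tmatroid F n) : nat :=
  matroid_rank (underlying M).

Definition covector (F : tract) (n : nat) (M : tmatroid F n) (Y : 'rV[F]_n) :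
    Prop :=
  forall X, tcircuit M X -> orthogonal X Y.

Section TractTheory.
Variable F : tract.
Implicit Types x y c d : F.

Lemma tmulr1 x : tmul x tone = x. Proof. by rewrite tmulC tmul1. Qed.
Lemma tmulr0 x : tmul x tzero = tzero. Proof. by rewrite tmulC tmul0. Qed.

Lemma tmul_neq0 x y : x <> tzero -> y <> tzero -> tmul x y <> tzero.
Proof.
move=> /tmulV[z xz] y0 xy; apply: y0.
by rewrite -(tmul1 y) -xz (tmulC x) -tmulA xy tmulr0.
Qed.

Lemma tdiv x y : x <> tzero -> y <> tzero ->
  exists2 c, c <> tzero & y = tmul c x.
Proof.
move=> x0 y0; case: (tmulV x0) => z xz.
have ze : y = tmul (tmul y z) x by rewrite -tmulA (tmulC z) xz tmulr1.
by exists (tmul y z) => // h; apply: y0; rewrite ze h tmul0.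
Qed.

Lemma tscale_scale n c d (X : 'rV[F]_n) :
  tscale c (tscale d X) = tscale (tmul c d) X.
Proof. by apply/rowP => i; rewrite !mxE tmulA. Qed.

Lemma vsupp_scale n c (X : 'rV[F]_n) : c <> tzero ->
  vsupp (tscale c X) = vsupp X.
Proof.
move=> c0; apply/setP => i; rewrite !inE mxE; congr (~~ _).
apply/eqP/eqP => [h|->]; last exact: tmulr0.
by case: (eqVneq (X ord0 i) tzero) => // /eqP/(tmul_neq0 c0).
Qed.

Lemma null_eq (s t : seq F) : s = t -> null s -> null t.
Proof. by move->. Qed.

End TractTheory.

Section PushForward.
Variables (F G : tract) (f : tract_hom F G) (n : nat).

Lemma thom_neq0 x : x <> tzero -> f x <> tzero.
Proof.
case/tmulV=> y xy fx; apply: (@tone_neq0 G).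
by rewrite -(thom1 f) -xy thomM fx tmul0.
Qed.

Lemma vsupp_thom (X : 'rV[F]_n) : vsupp (map_mx f X) = vsupp X.
Proof.
apply/setP => i; rewrite !inE mxE; congr (~~ _).
apply/eqP/eqP => [h|->]; last exact: thom0.
by case: (eqVneq (X ord0 i) tzero) => // /eqP/thom_neq0.
Qed.

Lemma thom_scale c (X : 'rV[F]_n) :
  map_mx f (tscale c X) = tscale (f c) (map_mx f X).
Proof. by apply/rowP => i; rewrite !mxE thomM. Qed.

Definition push_vectors (S : 'rV[F]_n -> Prop) (Y : 'rV[G]_n) : Prop :=
  exists c X, [/\ c <> tzero, S X & Y = tscale c (map_mx f X)].

Lemma push_signature D S : signature D S -> signature D (push_vectors S).
Proof.
case=> Ssc Ssu Sex Sun; split.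
- move=> c _ c0 [d [X [d0 SX ->]]]; exists (tmul c d), X; split=> //.
    exact: tmul_neq0.
  by rewrite tscale_scale.
- by move=> _ [c [X [c0 SX ->]]]; rewrite vsupp_scale // vsupp_thom; apply: Ssu.
- move=> C /Sex[X SX <-]; exists (tscale tone (map_mx f X)).
    by exists tone, X; split=> //; apply: tone_neq0.
  by rewrite vsupp_scale ?vsupp_thom //; apply: tone_neq0.
- move=> _ _ [c [X [c0 SX ->]]] [d [Y [d0 SY ->]]].
  rewrite !vsupp_scale // !vsupp_thom => /(Sun _ _ SX SY)[e e0 ->].
  have [b b0 eb] := tdiv c0 (tmul_neq0 d0 (thom_neq0 e0)).
  by exists b => //; rewrite thom_scale !tscale_scale eb.
Qed.

Lemma push_orthogonal (X Y : 'rV[F]_n) c d : c <> tzero -> d <> tzero ->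
  orthogonal X Y ->
  orthogonal (tscale c (map_mx f X)) (tscale d (map_mx f Y)).
Proof.
move=> c0 d0 /(thom_null f)/(null_scale (tmul_neq0 c0 d0)).
rewrite -2!map_comp; apply: null_eq; apply: eq_map => i /=.
rewrite !mxE thomM -!tmulA; congr (tmul c _).
by rewrite tmulA [tmul d _]tmulC -tmulA.
Qed.

Lemma push_circuit_orthogonal (M : tmatroid F n) X Y :
  push_vectors (tcircuit M) X -> push_vectors (tcocircuit M) Y ->
  orthogonal X Y.
Proof.
case=> c [X' [c0 CX ->]] [d [Y' [d0 CY ->]]].
exact/push_orthogonal/(tcircuit_orthogonal CX CY).
Qed.

Definition push_forward (M : tmatroid F n) : tmatroid G n :=
  TMatroid (push_signature (tcircuitP M)) (push_signature (tcocircuitP M))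
    (@push_circuit_orthogonal M).

End PushForward.

Section FreeMatroid.
Variables (F : tract) (n : nat).

Lemma free_bases_neq0 : [set [set: 'I_n]] != set0.
Proof. by apply/set0Pn; exists setT; rewrite inE. Qed.

Lemma free_exchange (B1 B2 : {set 'I_n}) x :
  B1 \in [set setT] -> B2 \in [set setT] ->
  x \in B1 :\: B2 ->
  exists2 y, y \in B2 :\: B1 & (y |: (B1 :\ x)) \in [set setT].
Proof. by move=> /set1P-> /set1P->; rewrite setDv inE. Qed.

Definition free_matroid : matroid 'I_n :=
  Matroid free_bases_neq0 free_exchange.

Lemma free_circuits C : C \notin circuits free_matroid.
Proof.
rewrite inE; apply/negP => /minsetp/forall_inP/(_ setT).
by rewrite inE eqxx subsetT => /(_ isT).
Qed.

Lemma free_cocircuits C :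
  (C \in cocircuits free_matroid) = [exists i, C == [set i]].
Proof.
have pE (X : {set 'I_n}) :
    [forall B in [set ~: B | B in bases free_matroid], ~~ (X \subset B)]
    = (X != set0).
  rewrite /= imset_set1 setCT; apply/forall_inP/idP => [|X0 B /set1P->].
    by move=> /(_ set0); rewrite inE eqxx subset0 => /(_ isT).
  by rewrite subset0.
rewrite inE; apply/minsetP/existsP => [[]|[i /eqP->]].
  rewrite pE => /set0Pn[i iC] Cmin; exists i.
  apply/eqP/esym/Cmin; last by rewrite sub1set.
  by rewrite pE; apply/set0Pn; exists i; rewrite inE.
split; first by rewrite pE; apply/set0Pn; exists i; rewrite inE.
move=> X; rewrite pE subset1 => X0 /orP[/eqP//|]; by rewrite (negPf X0).
Qed.

Lemma free_circuitP :
  signature (circuits free_matroid) (fun _ : 'rV[F]_n => False).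
Proof. by split=> // C; rewrite (negPf (free_circuits C)). Qed.

Lemma free_cocircuitP :
  signature (cocircuits free_matroid)
    (fun Y : 'rV[F]_n => exists i, vsupp Y = [set i]).
Proof.
split.
- by move=> c X c0; rewrite vsupp_scale.
- by move=> X [i Xi]; rewrite free_cocircuits; apply/existsP; exists i; rewrite Xi.
- move=> C; rewrite free_cocircuits => /existsP[i /eqP->].
  pose X : 'rV[F]_n := (\row_j (if j == i then tone else tzero))%R.
  have XE : vsupp X = [set i].
    apply/setP => j; rewrite !inE mxE; case: ifP => _; last by rewrite eqxx.
    exact/eqP/tone_neq0.
  by exists X => //; exists i.
- move=> X Y [i Xi] _ XY.
  have Z (Z : 'rV[F]_n) j : vsupp Z = [set i] ->
      (Z ord0 j != tzero) = (j == i).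
    by move/setP/(_ j); rewrite !inE.
  have Yi : vsupp Y = [set i] by rewrite -XY.
  have [| |c c0 e] := @tdiv F (X ord0 i) (Y ord0 i).
  + by apply/eqP; rewrite Z.
  + by apply/eqP; rewrite Z.
  exists c => //; apply/rowP => j; rewrite mxE.
  case: (eqVneq j i) => [->//|ji].
  have /eqP-> : Y ord0 j == tzero by rewrite -[_ == _]negbK Z.
  have /eqP-> : X ord0 j == tzero by rewrite -[_ == _]negbK Z.
  by rewrite tmulr0.
Qed.

Definition free_tmatroid : tmatroid F n :=
  TMatroid free_circuitP free_cocircuitP
    (fun X Y (abs : False) _ => match abs with end).

End FreeMatroid.

Section Ranks.
Variables (F : tract) (m n : nat) (A : 'M[F]_(m, n)).

Definition r_col : nat :=
  \max_(J : {set 'I_n} |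
        `[< ~ lin_dependent (fun j : {j : 'I_n | j \in J} => col (val j) A) >])
    #|J|.

Lemma r_mat_ex : exists r, exists2 M : tmatroid F n,
  trank M = r & forall i, covector M (row i A).
Proof.
by exists (trank (free_tmatroid F n)); exists (free_tmatroid F n) => // i X [].
Qed.

Definition r_mat : nat := least r_mat_ex.

End Ranks.

Section HomRank.
Variables (K F : tract) (f : tract_hom K F) (m n : nat) (A : 'M[F]_(m, n)).

Lemma r_hom_mat_ex : exists r, exists2 M : tmatroid K n,
  trank M = r & forall i, covector (push_forward f M) (row i A).
Proof.
exists (trank (free_tmatroid K n)); exists (free_tmatroid K n) => // i X.
by case=> c [Y [_ []]].
Qed.

Definition r_hom_mat : nat := least r_hom_mat_ex.

End HomRank.

Local Open Scope ring_scope.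

Section FieldTract.
Variable K : fieldType.

Definition field_null (s : seq K) : Prop := \sum_(x <- s) x = 0.

Fact field_one_neq0 : (1 : K) <> 0.
Proof. exact/eqP/oner_neq0. Qed.

Fact field_mulV (x : K) : x <> 0 -> exists y, x * y = 1.
Proof. by move/eqP=> x0; exists x^-1; rewrite divff. Qed.

Fact field_null_perm s t : perm_eq s t -> field_null s -> field_null t.
Proof. by move=> st; rewrite /field_null (perm_big _ st). Qed.

Fact field_null_cons0 s : field_null (0 :: s) <-> field_null s.
Proof. by rewrite /field_null big_cons add0r. Qed.

Fact field_null_nil : field_null [::].
Proof. exact: big_nil. Qed.

Fact field_null_eps : exists! e : K, e <> 0 /\ field_null [:: 1; e].
Proof.
exists (-1); split=> [|e [_]]; rewrite /field_null !big_cons big_nil addr0.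
  by rewrite subrr; split=> //; apply/eqP; rewrite oppr_eq0 oner_neq0.
by move/eqP; rewrite addr_eq0 => /eqP->; rewrite opprK.
Qed.

Fact field_null_scale (c : K) s : c <> 0 ->
  field_null s -> field_null [seq c * x | x <- s].
Proof. by move=> _ s0; rewrite /field_null big_map -mulr_sumr s0 mulr0. Qed.

Definition field_tract : tract :=
  Tract (@mulrA K) (@mulrC K) (@mul1r K) (@mul0r K) field_one_neq0 field_mulV
    field_null_perm field_null_cons0 field_null_nil field_null_eps
    field_null_scale.

End FieldTract.

Record unit_subgroup (K : fieldType) := UnitSubgroup {
  usg_pred :> {pred K};
  usg_closed : divr_closed usg_pred;
  usg_0 : 0 \notin usg_pred
}.

Section QuotientHyperfield.
Variables (K : fieldType) (H : unit_subgroup K).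

(* Since 0^-1 = 0 and 0 is not in H, x / y \in H forces x and y to be nonzero. *)
Definition same_coset (x y : K) : bool :=
  ((x == 0) && (y == 0)) || (x / y \in H).

Lemma usg1 : 1 \in H. Proof. by case: (usg_closed H). Qed.
Lemma usg_div x y : x \in H -> y \in H -> x / y \in H.
Proof. by case: (usg_closed H) => _; apply. Qed.
Lemma usgV x : x \in H -> x^-1 \in H.
Proof. by move=> xH; rewrite -div1r usg_div // usg1. Qed.
Lemma usgM x y : x \in H -> y \in H -> x * y \in H.
Proof. by move=> xH yH; rewrite -[y]invrK usg_div // usgV. Qed.
Lemma usg_neq0 x : x \in H -> x != 0.
Proof. by move=> xH; apply: contraTneq xH => ->; apply: usg_0. Qed.

Lemma same_cosetP x y :
  reflect (exists2 h, h \in H & x = h * y) (same_coset x y).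
Proof.
apply: (iffP orP) => [[/andP[/eqP-> /eqP->]|xyH]|[h hH ->]].
- by exists 1; rewrite ?usg1 ?mulr0.
- exists (x / y) => //; rewrite divfK //.
  by apply: contraTneq xyH => ->; rewrite invr0 mulr0 usg_0.
- case: (eqVneq y 0) => [->|y0]; first by left; rewrite mulr0 eqxx.
  by right; rewrite mulfK.
Qed.

Lemma same_coset_refl : reflexive same_coset.
Proof. by move=> x; apply/same_cosetP; exists 1; rewrite ?usg1 ?mul1r. Qed.

Lemma same_coset_sym : symmetric same_coset.
Proof.
suff S x y : same_coset x y -> same_coset y x by move=> x y; apply/idP/idP; apply: S.
case/same_cosetP => h hH ->; apply/same_cosetP; exists h^-1; first exact: usgV.
by rewrite mulKf // usg_neq0.
Qed.

Lemma same_coset_trans : transitive same_coset.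
Proof.
move=> y x z /same_cosetP[h hH ->] /same_cosetP[k kH ->].
by apply/same_cosetP; exists (h * k); rewrite ?usgM ?mulrA.
Qed.

Definition same_coset_equiv : equiv_rel K :=
  EquivRel same_coset same_coset_refl same_coset_sym same_coset_trans.

Definition coset_type : choiceType := {eq_quot same_coset_equiv}%qT.

Definition coset_of_elt (x : K) : coset_type := (\pi_({eq_quot same_coset_equiv}) x)%qT.
Definition coset_repr (x : coset_type) : K :=
  repr (x : {eq_quot same_coset_equiv}%qT).

Definition coset_mul (x y : coset_type) : coset_type :=
  coset_of_elt (coset_repr x * coset_repr y).

Definition coset_null (s : seq coset_type) : Prop :=
  exists2 t : seq K, [seq coset_of_elt x | x <- t] = s & \sum_(x <- t) x = 0.

Lemma coset_reprK : cancel coset_repr coset_of_elt.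
Proof. by move=> x; apply: reprK. Qed.

Lemma coset_eqP x y :
  coset_of_elt x = coset_of_elt y <-> exists2 h, h \in H & x = h * y.
Proof.
split=> [/eqmodP/same_cosetP//|h]; by apply/eqmodP/same_cosetP.
Qed.

Lemma coset_ind (P : coset_type -> Prop) :
  (forall x, P (coset_of_elt x)) -> forall x, P x.
Proof. by move=> h x; rewrite -(coset_reprK x). Qed.

Lemma coset_mulE x y :
  coset_mul (coset_of_elt x) (coset_of_elt y) = coset_of_elt (x * y).
Proof.
apply/coset_eqP.
have [h hH ->] := (coset_eqP _ _).1 (coset_reprK (coset_of_elt x)).
have [k kH ->] := (coset_eqP _ _).1 (coset_reprK (coset_of_elt y)).
by exists (h * k); rewrite ?usgM // mulrACA.
Qed.

Lemma coset_eq0 x : coset_of_elt x = coset_of_elt 0 <-> x = 0.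
Proof. by split=> [/coset_eqP[h _ ->]|->]; rewrite ?mulr0. Qed.

Fact coset_mulA : associative coset_mul.
Proof.
elim/coset_ind=> x; elim/coset_ind=> y; elim/coset_ind=> z.
by rewrite !coset_mulE mulrA.
Qed.

Fact coset_mulC : commutative coset_mul.
Proof.
by elim/coset_ind=> x; elim/coset_ind=> y; rewrite !coset_mulE mulrC.
Qed.

Fact coset_mul1 : left_id (coset_of_elt 1) coset_mul.
Proof. by elim/coset_ind=> x; rewrite coset_mulE mul1r. Qed.

Fact coset_mul0 : left_zero (coset_of_elt 0) coset_mul.
Proof. by elim/coset_ind=> x; rewrite coset_mulE mul0r. Qed.

Fact coset_one_neq0 : coset_of_elt 1 <> coset_of_elt 0.
Proof. by move/coset_eq0/eqP; rewrite oner_eq0. Qed.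

Fact coset_mulV x : x <> coset_of_elt 0 ->
  exists y, coset_mul x y = coset_of_elt 1.
Proof.
elim/coset_ind: x => x x0; exists (coset_of_elt x^-1).
by rewrite coset_mulE divff //; apply/eqP => /coset_eq0.
Qed.

Fact coset_null_perm s t : perm_eq s t -> coset_null s -> coset_null t.
Proof.
rewrite perm_sym => st [u us u0]; subst s.
have [I Iperm ->] := perm_iotaP (coset_of_elt 0) st.
rewrite size_map in Iperm; exists [seq nth 0 u i | i <- I].
  rewrite -map_comp; apply/eq_in_map => i iI /=.
  rewrite (nth_map 0) //; move: iI.
  by rewrite (perm_mem Iperm) mem_iota.
rewrite big_map (perm_big _ Iperm) /= -[RHS]u0.
by rewrite -[in RHS](mkseq_nth 0 u) big_map.
Qed.

Fact coset_null_cons0 s : coset_null (coset_of_elt 0 :: s) <-> coset_null s.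
Proof.
split=> [[[|x t] //= [/coset_eq0-> ts]]|[t ts t0]].
  by rewrite big_cons add0r; exists t.
by exists (0 :: t); rewrite /= ?ts ?big_cons ?add0r.
Qed.

Fact coset_null_nil : coset_null [::].
Proof. by exists [::]; rewrite ?big_nil. Qed.

Fact coset_null_eps :
  exists! e, e <> coset_of_elt 0 /\ coset_null [:: coset_of_elt 1; e].
Proof.
exists (coset_of_elt (-1)); split=> [|e [_]].
  split; first by move/coset_eq0/eqP; rewrite oppr_eq0 oner_eq0.
  by exists [:: 1; -1] => //; rewrite !big_cons big_nil addr0 subrr.
case=> -[|x [|y []]] //= [/coset_eqP[h hH ->] <-].
rewrite !big_cons big_nil addr0 mulr1 => /eqP.
rewrite addrC addr_eq0 => /eqP->; apply/coset_eqP.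
by exists h^-1; rewrite ?usgV // mulrN mulVf // usg_neq0.
Qed.

Fact coset_null_scale c s : c <> coset_of_elt 0 ->
  coset_null s -> coset_null [seq coset_mul c x | x <- s].
Proof.
elim/coset_ind: c => c _ [t <- t0]; exists [seq c * x | x <- t].
  by rewrite -!map_comp; apply: eq_map => x /=; rewrite coset_mulE.
by rewrite big_map -mulr_sumr t0 mulr0.
Qed.

Definition quotient_hyperfield : tract :=
  Tract coset_mulA coset_mulC coset_mul1 coset_mul0 coset_one_neq0 coset_mulV
    coset_null_perm coset_null_cons0 coset_null_nil coset_null_eps
    coset_null_scale.

Fact coset_morphM : {morph coset_of_elt : x y / x * y >-> coset_mul x y}.
Proof. by move=> x y; rewrite coset_mulE. Qed.

Fact coset_morph_null s : field_null s ->
  coset_null [seq coset_of_elt x | x <- s].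
Proof. by exists s. Qed.

Definition quotient_map : tract_hom (field_tract K) quotient_hyperfield :=
  @TractHom (field_tract K) quotient_hyperfield coset_of_elt
    (erefl _) (erefl _) coset_morphM coset_morph_null.

Section LiftRank.
Variables (m n : nat) (A : 'M[quotient_hyperfield]_(m, n)).

(* r_mat(phi^{-1}(A)), with the usual rank of matrices over the field K. *)
Lemma r_lift_ex : exists r, exists2 A' : 'M[K]_(m, n),
  \rank A' = r & map_mx quotient_map A' = A.
Proof.
pose A' : 'M[K]_(m, n) := map_mx coset_repr A.
exists (\rank A'); exists A' => //.
by apply/matrixP => i j; rewrite !mxE; apply: coset_reprK.
Qed.

Definition r_lift : nat := least r_lift_ex.

End LiftRank.

End QuotientHyperfield.

(* Main.v *)
(* Having rank less than n amounts, for each of the four ranks, to the existence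
   of a nonzero vector c orthogonal to all rows of A. A matroid of rank less than
   n has a circuit, which can be taken for c; conversely any nonzero c is, up to
   scaling, the only circuit of a matroid of rank n - 1, whose covectors are the
   vectors orthogonal to c. Over a quotient hyperfield, representatives of the
   terms of the null sums, divided by representatives of the entries of c, form a
   lift of A that kills a lift of c. *)
Require Import Defs.
From mathcomp Require Import all_boot all_order all_algebra.
From mathcomp Require Import boolp.
(* MathComp has its own orthogonal. *)
Import Defs.

Set Implicit Arguments.
Unset Strict Implicit.
Unset Printing Implicit Defensive.

Import GRing.Theory.

(** * Null sums in a tract *)

Section NullSums.
Variable F : tract.
Implicit Types a b c : F.

Lemma null_cat0 (z s : seq F) :
  all (pred1 tzero) z -> null (z ++ s) <-> null s.
Proof. by elim: z => //= x z IH /andP[/eqP-> /IH <-]; apply: null_cons0. Qed.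

Lemma null_permE (s t : seq F) : perm_eq s t -> null s <-> null t.
Proof. by move=> st; split; apply: null_perm; rewrite // perm_sym. Qed.

(** Order and zero terms are irrelevant in a formal sum, so the indices outside [t] can be moved to
    the front and discarded. This reduces orthogonality to the few coordinates in a small
    support. *)
Lemma null_image_sub (I : finType) (f : I -> F) (t : seq I) : uniq t ->
  (forall i, i \notin t -> f i = tzero) ->
  null [seq f i | i : I] <-> null [seq f i | i <- t].
Proof.
move=> ut f0; pose z := [seq f i | i <- enum I & i \notin t].
have z0 : all (pred1 tzero) z.
  apply/allP => _ /mapP[i + ->]; rewrite mem_filter => /andP[/f0 fi _].
  exact/eqP.
rewrite -[X in _ <-> X](null_cat0 _ z0); apply: null_permE.
rewrite -map_cat; apply: perm_map.
rewrite -(perm_filterC (fun i => i \notin t) (enum I)).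
rewrite perm_cat2l; apply: uniq_perm => //; first exact/filter_uniq/enum_uniq.
by move=> i; rewrite mem_filter /= negbK mem_enum inE andbT.
Qed.

Lemma null_image_bij (I J : finType) (h : I -> J) (f : J -> F) :
  bijective h -> null [seq f (h i) | i : I] <-> null [seq f j | j : J].
Proof.
move=> bh; apply: null_permE.
rewrite [[seq f (h i) | i : I]](map_comp f h); apply: perm_map.
apply: uniq_perm; first by rewrite (map_inj_uniq (bij_inj bh)) enum_uniq.
  exact: enum_uniq.
case: bh => g hK gK j; rewrite mem_enum; apply/mapP.
by exists (g j); rewrite ?mem_enum ?gK.
Qed.

Lemma tmul_inj a b c : a <> tzero -> tmul a b = tmul a c -> b = c.
Proof.
case/tmulV=> y ay e.
by rewrite -(tmul1 b) -(tmul1 c) -ay (tmulC a) -!tmulA e.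
Qed.

Lemma null2_ex a : a <> tzero -> exists2 b, b <> tzero & null [:: a; b].
Proof.
move=> a0; have [e [[e0 ne] _]] := null_eps F.
exists (tmul a e); first exact: tmul_neq0.
by have := null_scale a0 ne; rewrite /= tmulr1.
Qed.

(** Scaling by the inverse of [a] turns both sums into null sums starting with [tone], whose second
    term is unique by [null_eps]. *)
Lemma null2_uniq a b c : a <> tzero -> b <> tzero -> c <> tzero ->
  null [:: a; b] -> null [:: a; c] -> b = c.
Proof.
move=> a0 b0 c0 nb nc; have [e [_ eU]] := null_eps F.
have [v va] := tmulV a0.
have v0 : v <> tzero.
  by move=> v0; apply: (@tone_neq0 F); rewrite -va v0 tmulr0.
have E x : x <> tzero -> null [:: a; x] -> tmul v x = e.
  move=> x0 nx; apply/esym/eU; split; first exact: tmul_neq0.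
  by have := null_scale v0 nx; rewrite /= [tmul v a]tmulC va.
by apply: (tmul_inj v0); rewrite !E.
Qed.

End NullSums.

(** * Supports and orthogonality of vectors over a tract *)

Section Vectors.
Variables (F : tract) (n : nat).
Implicit Types (c X Y : 'rV[F]_n).

Lemma vsuppP X i : reflect (X ord0 i <> tzero) (i \in vsupp X).
Proof. by rewrite inE; apply: (iffP idP) => /eqP. Qed.

Lemma vsupp_notin X i : i \notin vsupp X -> X ord0 i = tzero.
Proof. by rewrite inE negbK => /eqP. Qed.

Lemma orthogonal_scale d e X Y : d <> tzero -> e <> tzero ->
  orthogonal X Y -> orthogonal (tscale d X) (tscale e Y).
Proof.
move=> d0 e0 /(null_scale (tmul_neq0 d0 e0)); rewrite -map_comp.
apply: null_eq; apply: eq_map => i /=.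
by rewrite !mxE -!tmulA; congr (tmul d _); rewrite tmulA [tmul e _]tmulC -tmulA.
Qed.

Lemma tscale1 X : tscale tone X = X.
Proof. by apply/rowP => i; rewrite mxE tmul1. Qed.

Lemma orthogonal_pair c X x y : x != y -> vsupp X = [set x; y] ->
  orthogonal c X <->
  null [:: tmul (c ord0 x) (X ord0 x); tmul (c ord0 y) (X ord0 y)].
Proof.
move=> xy Xxy; rewrite /orthogonal.
rewrite (@null_image_sub _ _ _ [:: x; y]) //=; first by rewrite inE xy.
move=> i; rewrite !inE -in_set2 -Xxy => /vsupp_notin->; exact: tmulr0.
Qed.

Lemma orthogonal_disjoint c X : [disjoint vsupp c & vsupp X] -> orthogonal c X.
Proof.
move=> /pred0P dj; rewrite /orthogonal.
rewrite (@null_image_sub _ _ _ [::]) //=; first exact: null_nil.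
move=> i _; have /= := dj i; case: (boolP (i \in vsupp c)) => /= [_ /negbT|].
  by move/vsupp_notin->; rewrite tmulr0.
by move/vsupp_notin->; rewrite tmul0.
Qed.

End Vectors.

(** * Circuits of a matroid of less than full rank *)

Section Circuits.
Variables (E : finType) (M : matroid E).

Lemma circuit_neq0 C : C \in circuits M -> C != set0.
Proof.
rewrite inE => /minsetp/forall_inP Cd; have /set0Pn[B BM] := bases_neq0 M.
by apply: contraNneq (Cd B BM) => ->; apply: sub0set.
Qed.

(** No basis is the whole ground set, which is therefore dependent and contains a minimal dependent
    set. *)
Lemma circuit_ex : matroid_rank M < #|E| -> exists C, C \in circuits M.
Proof.
move=> rk.
have [|C Cmin _] := @minset_exists _ (fun X : {set E} =>
    [forall B in bases M, ~~ (X \subset B)]) setT.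
  apply/forall_inP => B BM; apply: contraL rk => TB; rewrite -leqNgt.
  by rewrite -cardsT (leq_trans (subset_leq_card TB)) // (leq_bigmax_cond _ BM).
by exists C; rewrite inE.
Qed.

Lemma matroid_rank_le : matroid_rank M <= #|E|.
Proof. by apply/bigmax_leqP => B _; apply: max_card. Qed.

End Circuits.

(** * The matroid with a single prescribed circuit *)

Section OneCircuit.
Variables (E : finType) (C : {set E}) (C0 : C != set0).

(** A set lies in no such basis exactly when it contains [C]; the elements outside [C] are
    coloops. *)
Let bs : {set {set E}} := [set ~: [set x] | x in C].

Lemma one_circuit_bases_neq0 : bs != set0.
Proof.
by have /set0Pn[x xC] := C0; apply/set0Pn; exists (~: [set x]); apply: imset_f.
Qed.

Lemma one_circuit_exchange B1 B2 x : B1 \in bs -> B2 \in bs ->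
  x \in B1 :\: B2 -> exists2 y, y \in B2 :\: B1 & (y |: (B1 :\ x)) \in bs.
Proof.
case/imsetP=> x1 _ -> /imsetP[x2 x2C ->].
rewrite !inE negbK => /andP[/eqP-> x21].
(* The exchanged element is the one that [B2] omits; replacing it by [x1], which [B1] omits, gives
   [B2] itself. *)
exists x1; first by rewrite !inE eqxx eq_sym x21.
rewrite (_ : _ |: _ = ~: [set x2]); first exact: imset_f.
apply/setP => i; rewrite !inE.
case: (eqVneq i x1) => [->|]; last by rewrite andbT.
by rewrite eq_sym x21.
Qed.

Definition one_circuit_matroid : matroid E :=
  Matroid one_circuit_bases_neq0 one_circuit_exchange.

Lemma one_circuit_circuits : circuits one_circuit_matroid = [set C].
Proof.
have pE (X : {set E}) :
    [forall B in bs, ~~ (X \subset B)] = (C \subset X).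
  apply/forall_inP/subsetP => [Xd x xC|CX _ /imsetP[x xC ->]].
    have := Xd _ (imset_f _ xC); rewrite subsetC sub1set inE negbK; exact.
  by rewrite subsetC sub1set inE negbK CX.
apply/setP => X; rewrite !inE; apply/minsetP/eqP => [[]|->].
  by rewrite pE => CX Xmin; apply/esym/Xmin; rewrite ?pE.
split; first by rewrite pE.
by move=> B; rewrite pE => CB BC; apply/eqP; rewrite eqEsubset BC.
Qed.

(** The dual has rank one, its bases being the singletons of [C]. Its circuits are thus its loops,
    the elements outside [C], and the pairs of parallel elements, those inside [C]. *)
Lemma one_circuit_cocircuitP (D : {set E}) :
  reflect ((exists2 x, x \notin C & D = [set x]) \/
           (exists x y, [/\ x \in C, y \in C, x != y & D = [set x; y]]))
          (D \in cocircuits one_circuit_matroid).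
Proof.
pose p (X : {set E}) :=
  [forall B in [set ~: B | B in bs], ~~ (X \subset B)].
have pP (X : {set E}) :
    reflect (forall x, x \in C -> ~~ (X \subset [set x])) (p X).
  apply: (iffP forall_inP) => [Xd x xC|Xd _ /imsetP[_ /imsetP[x xC ->] ->]].
    by apply/Xd/imsetP; exists (~: [set x]); [apply: imset_f | rewrite setCK].
  by rewrite setCK Xd.
have p1 x : x \notin C -> p [set x].
  move=> xC; apply/pP => y yC; rewrite sub1set inE.
  by apply: contraNneq xC => ->.
have p2 x y : x != y -> p [set x; y].
  move=> xy; apply/pP => z _; rewrite subUset !sub1set !inE.
  by apply: contra xy => /andP[/eqP-> /eqP->].
have pN0 : ~~ p set0.
  by have /set0Pn[x xC] := C0; apply/pP => /(_ x xC); rewrite sub0set.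
rewrite inE; apply: (iffP minsetP) => [[pD Dmin]|].
  have [DC|/subsetPn[x xD xC]] := boolP (D \subset C); last first.
    left; exists x => //; apply/esym/Dmin; [exact: p1 | by rewrite sub1set].
  have /set0Pn[x xD] : D != set0 by apply: contraTneq pD => ->.
  have xC := subsetP DC _ xD.
  (* [D] is dependent in the dual, so it is not contained in the basis [[set x]] and has a second
     element. *)
  have /subsetPn[y yD] := (pP _ pD) x xC; rewrite inE eq_sym => xy.
  right; exists x, y; split=> //; first exact: (subsetP DC).
  apply/esym/Dmin; [exact: p2 | by rewrite subUset !sub1set xD].
case=> [[x xC ->]|[x [y [xC yC xy ->]]]].
  split=> [|B pB]; first exact: p1.
  by rewrite subset1 => /orP[/eqP//|/eqP B0]; case/negP: pN0; rewrite -B0.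
split=> [|B pB BD]; first exact: p2.
apply/eqP; rewrite eqEsubset BD subUset !sub1set /=; apply/andP; split.
  have /subsetPn[z zB] := (pP _ pB) y yC; have := subsetP BD z zB.
  by rewrite !inE => /orP[/eqP<-//|->].
have /subsetPn[z zB] := (pP _ pB) x xC; have := subsetP BD z zB.
by rewrite !inE => /orP[->//|/eqP<-].
Qed.

Lemma one_circuit_rank : matroid_rank one_circuit_matroid < #|E|.
Proof.
have /set0Pn[x0 _] := C0; have E0 : 0 < #|E| by apply/card_gt0P; exists x0.
rewrite -(prednK E0) ltnS; apply/bigmax_leqP => _ /imsetP[x _ ->].
by rewrite -(cardsC [set x]) cards1.
Qed.

End OneCircuit.

(** * The one-circuit matroid over a tract *)

Section OneCircuitTract.
Variables (F : tract) (n : nat) (c : 'rV[F]_n) (c0 : vsupp c != set0).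

Let M := one_circuit_matroid c0.

Definition multiple_of (X : 'rV[F]_n) : Prop :=
  exists2 d, d <> tzero & X = tscale d c.

Lemma one_circuit_signature : signature (circuits M) multiple_of.
Proof.
rewrite one_circuit_circuits; split.
- move=> d _ d0 [e e0 ->]; exists (tmul d e); first exact: tmul_neq0.
  by rewrite tscale_scale.
- by move=> _ [d d0 ->]; rewrite vsupp_scale // inE.
- move=> C /set1P->; exists c => //; exists tone; first exact: tone_neq0.
  by rewrite tscale1.
- move=> _ _ [d d0 ->] [e e0 ->] _; have [b b0 ->] := tdiv d0 e0.
  by exists b; rewrite ?tscale_scale.
Qed.

(** On a singleton outside the support of [c] orthogonality is automatic; on a pair inside it,
    orthogonality fixes the ratio of the two entries. *)
Definition orthogonal_cocircuit (Y : 'rV[F]_n) : Prop :=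
  vsupp Y \in cocircuits M /\ orthogonal c Y.

Lemma one_circuit_cosignature :
  signature (cocircuits M) orthogonal_cocircuit.
Proof.
split.
- move=> d Y d0 [YM cY]; split; first by rewrite vsupp_scale.
  by rewrite -[c]tscale1; apply: orthogonal_scale => //; apply: tone_neq0.
- by move=> Y [].
- move=> D DM.
  have [[x xc De]|[x [y [xc yc xy De]]]] := one_circuit_cocircuitP c0 D DM.
    pose Y : 'rV[F]_n := (\row_j (if j == x then tone else tzero))%R.
    have YD : vsupp Y = D.
      apply/setP => j; rewrite De !inE mxE; case: ifP => _; last by rewrite eqxx.
      exact/eqP/tone_neq0.
    exists Y => //; split; rewrite ?YD //; apply: orthogonal_disjoint.
    by rewrite YD De disjoint_sym disjoints1.
  (* With entry [tone] at [x], the entry [d] at [y] must make [c ord0 x] plus [d] times [c ord0 y]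
     null: [d] is the quotient by [c ord0 y] of a term [b] completing [c ord0 x]. *)
  have [b b0 nb] := null2_ex (vsuppP _ _ xc).
  have [d d0 bE] := tdiv (vsuppP _ _ yc) b0.
  pose Y : 'rV[F]_n := (\row_j
    (if j == x then tone else if j == y then d else tzero))%R.
  have YD : vsupp Y = [set x; y].
    apply/setP => j; rewrite !inE mxE.
    case: (j == x) => /=; first exact/eqP/tone_neq0.
    by case: (j == y) => /=; [apply/eqP | rewrite eqxx].
  exists Y; rewrite ?YD //; split; first by rewrite YD -De.
  apply/(orthogonal_pair _ xy YD); rewrite !mxE eqxx eq_sym (negPf xy) eqxx.
  by rewrite tmulr1 tmulC -bE.
- move=> X Y [XM cX] [_ cY] XY.
  case/one_circuit_cocircuitP: (XM) => [[x _ Xx]|[x [y [xc yc xy Xxy]]]].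
    have Yx : vsupp Y = [set x] by rewrite -XY.
    have [| |d d0 e] := @tdiv F (X ord0 x) (Y ord0 x).
    + by apply/vsuppP; rewrite Xx set11.
    + by apply/vsuppP; rewrite Yx set11.
    exists d => //; apply/rowP => j; rewrite mxE.
    have [->//|jx] := eqVneq j x.
    by rewrite !vsupp_notin ?tmulr0 ?Xx ?Yx ?inE.
  have Yxy : vsupp Y = [set x; y] by rewrite -XY.
  have nz (Z : 'rV[F]_n) : vsupp Z = [set x; y] ->
      Z ord0 x <> tzero /\ Z ord0 y <> tzero.
    by move=> Ze; split; apply/vsuppP; rewrite Ze !inE eqxx ?orbT.
  have [X0x X0y] := nz X Xxy; have [Y0x Y0y] := nz Y Yxy.
  have [d d0 dx] := tdiv X0x Y0x.
  exists d => //; apply/rowP => j; rewrite mxE.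
  have [->//|jx] := eqVneq j x.
  have [->|jy] := eqVneq j y; last first.
    by rewrite !vsupp_notin ?tmulr0 ?Xxy ?Yxy ?inE ?negb_or ?jx.
  have c0x := vsuppP _ _ xc; have c0y := vsuppP _ _ yc.
  (* The factor [d] was fixed at [x]. At [y], both candidate entries, once multiplied by [c ord0 y],
     complete the same term at [x] to a null sum, hence agree. *)
  apply: (tmul_inj c0y).
  apply: (@null2_uniq _ (tmul (c ord0 x) (Y ord0 x))).
  + exact: tmul_neq0.
  + exact: tmul_neq0.
  + by do 2?apply: tmul_neq0.
  + exact/(orthogonal_pair _ xy Yxy).
  + have /(null_scale d0) := (orthogonal_pair _ xy Xxy).1 cX.
    by rewrite /= dx !(tmulA d) !(tmulC d) -!tmulA !(tmulC _ d).
Qed.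

Lemma one_circuit_orthogonal X Y :
  multiple_of X -> orthogonal_cocircuit Y -> orthogonal X Y.
Proof.
case=> d d0 -> [_ cY]; rewrite -[Y]tscale1.
by apply: orthogonal_scale => //; apply: tone_neq0.
Qed.

Definition one_circuit_tmatroid : tmatroid F n :=
  TMatroid one_circuit_signature one_circuit_cosignature
    one_circuit_orthogonal.

Lemma one_circuit_trank : trank one_circuit_tmatroid < n.
Proof. by rewrite -[n in _ < n]card_ord; apply: one_circuit_rank. Qed.

End OneCircuitTract.

Lemma trank_le (F : tract) n (M : tmatroid F n) : trank M <= n.
Proof. by rewrite -[n in _ <= n]card_ord; apply: matroid_rank_le. Qed.

Lemma tcircuit_ex (F : tract) n (M : tmatroid F n) : trank M < n ->
  exists2 X, tcircuit M X & vsupp X != set0.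
Proof.
rewrite -[n in _ < n]card_ord => /circuit_ex[C CM].
have [X MX Xe] := sig_ex (tcircuitP M) CM.
by exists X; rewrite // Xe (circuit_neq0 CM).
Qed.

Lemma least_eqP (P : nat -> Prop) (exP : exists k, P k) n :
  (forall k, P k -> k <= n) -> least exP = n <-> ~ exists2 k, k < n & P k.
Proof.
move=> Pn; rewrite /least; case: ex_minnP => k /asboolP Pk kmin.
split=> [<- [j jk /asboolP/kmin]|nP]; first by rewrite leqNgt jk.
apply/eqP; rewrite eqn_leq Pn // leqNgt.
by apply/negP => kn; apply: nP; exists k.
Qed.

(** * Full rank as absence of a nonzero kernel vector *)

Section Kernels.
Variables (F : tract) (m n : nat).

Definition in_kernel (A : 'M[F]_(m, n)) (c : 'rV[F]_n) : Prop :=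
  forall i, orthogonal c (row i A).

(** Only the full index set has [n] elements, so the rank is [n] exactly when all columns together
    are independent; the coefficients of a dependence among them form a kernel vector. *)
Lemma r_colP (A : 'M[F]_(m, n)) :
  r_col A = n <-> ~ exists2 c, vsupp c != set0 & in_kernel A c.
Proof.
pose T (J : {set 'I_n}) := {j : 'I_n | j \in J}.
have depE : lin_dependent (fun j : T setT => col (val j) A) <->
    exists2 c, vsupp c != set0 & in_kernel A c.
  pose h j : T setT := exist _ j (in_setT j).
  have hK : cancel h val by [].
  have vK : cancel val h by move=> j; apply: val_inj.
  have vbij : bijective (val : T setT -> 'I_n) := Bijective vK hK.
  split=> [[c [i ci] cA]|[c /set0Pn[i ic] cA]].
    exists (\row_j c (h j))%R.
      by apply/set0Pn; exists (val i); apply/vsuppP; rewrite mxE vK.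
    move=> k; rewrite /orthogonal.
    apply/(null_image_bij _ vbij)/(null_eq _ (cA k)).
    by apply: eq_map => j; rewrite !mxE vK.
  exists (fun j => c ord0 (val j)); first by exists (h i); apply/vsuppP.
  move=> k; have /(null_image_bij _ vbij) := cA k; apply: null_eq.
  by apply: eq_map => j; rewrite !mxE.
have le_n (J : {set 'I_n}) : #|J| <= n.
  by rewrite -[n in _ <= n]card_ord max_card.
split=> [rn /depE dT|/(contra_not depE.1)/asboolP iT].
  (* The dependence has a nonzero coefficient at some index, so [n.-1] is a genuine predecessor. *)
  have n0 : 0 < n.
    by case: dT => _ [[i _] _] _; apply: leq_ltn_trans (ltn_ord i).
  suff : r_col A <= n.-1 by rewrite rn -ltnS prednK ?ltnn.
  apply/bigmax_leqP => J /asboolP iJ; rewrite -ltnS prednK // ltn_neqAle le_n.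
  rewrite andbT; apply: contra_notN iJ => /eqP Jn.
  suff -> : J = setT by [].
  by apply/eqP; rewrite eqEcard subsetT cardsT card_ord Jn leqnn.
apply/eqP; rewrite eqn_leq; apply/andP; split; first exact/bigmax_leqP.
apply: (@leq_trans #|[set: 'I_n]|); first by rewrite cardsT card_ord.
exact: (leq_bigmax_cond _ iT).
Qed.

Lemma r_matP (A : 'M[F]_(m, n)) :
  r_mat A = n <-> ~ exists2 c, vsupp c != set0 & in_kernel A c.
Proof.
rewrite /r_mat least_eqP; last by move=> _ [M <- _]; apply: trank_le.
apply: not_iff_compat; split=> [[k kn [M Mk MA]]|[c c0 cA]].
  have [|X MX X0] := @tcircuit_ex _ _ M; first by rewrite Mk.
  by exists X => // i; apply: MA.
exists (trank (one_circuit_tmatroid c0)); first exact: one_circuit_trank.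
exists (one_circuit_tmatroid c0) => // i X [d d0 ->].
rewrite -[row i A]tscale1; apply: orthogonal_scale => //; exact: tone_neq0.
Qed.

Lemma r_hom_matP (K : tract) (f : tract_hom K F) (A : 'M[F]_(m, n)) :
  r_hom_mat f A = n <->
  ~ exists2 c : 'rV[K]_n, vsupp c != set0 & in_kernel A (map_mx f c).
Proof.
rewrite /r_hom_mat least_eqP; last by move=> _ [M <- _]; apply: trank_le.
apply: not_iff_compat; split=> [[k kn [M Mk MA]]|[c c0 cA]].
  have [|X MX X0] := @tcircuit_ex _ _ M; first by rewrite Mk.
  exists X => // i; apply: MA; exists tone, X; split=> //.
    exact: tone_neq0.
  by rewrite tscale1.
exists (trank (one_circuit_tmatroid c0)); first exact: one_circuit_trank.
exists (one_circuit_tmatroid c0) => // i _ [e [_ [e0 [d d0 ->] ->]]].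
(* A circuit of the push-forward is a scaled image of a multiple of [c], hence a nonzero multiple of
   the image of [c]. *)
rewrite thom_scale tscale_scale -[row i A]tscale1.
apply: orthogonal_scale; [exact/tmul_neq0/thom_neq0 | exact: tone_neq0 |].
exact: cA.
Qed.

End Kernels.

Local Open Scope ring_scope.

(** * Lifting kernel vectors and matrices from the quotient hyperfield to the field *)

Section Lifts.
Variables (K : fieldType) (H : unit_subgroup K) (m n : nat).
Notation F := (quotient_hyperfield H).

Lemma quotient_map_surj p q (B : 'M[F]_(p, q)) :
  exists B' : 'M[K]_(p, q), map_mx (quotient_map H) B' = B.
Proof.
exists (map_mx (@coset_repr K H) B).
by apply/matrixP => i j; rewrite !mxE; apply: coset_reprK.
Qed.

Lemma coset_mul_eqE (a : F) (c t : K) : c != 0 ->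
  coset_of_elt H t = coset_mul (coset_of_elt H c) a ->
  coset_of_elt H (t / c) = a.
Proof.
elim/coset_ind: a => a c0; rewrite coset_mulE => /coset_eqP[h hH ->].
by apply/coset_eqP; exists h; rewrite // mulrCA [c * _]mulrC mulfK.
Qed.

Lemma lift_row (c : 'rV[K]_n) (a : 'rV[F]_n) :
  orthogonal (map_mx (quotient_map H) c) a ->
  exists2 a' : 'rV[K]_n, map_mx (quotient_map H) a' = a &
    \sum_j a' 0 j * c 0 j = 0.
Proof.
case=> t te t0; have [b bE] := quotient_map_surj a.
have st : size t = n.
  by rewrite -(size_map (coset_of_elt H)) te size_image card_ord.
have tE (j : 'I_n) : coset_of_elt H t`_j =
    coset_mul (coset_of_elt H (c 0 j)) (a 0 j).
  rewrite -(nth_map _ (tzero : F)) ?st // te (nth_map j) ?size_enum_ord //.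
  by rewrite nth_ord_enum mxE.
(* Where [c] vanishes, the entry does not affect the sum, and any representative of the entry of [a]
   serves. *)
exists (\row_j (if c 0 j == 0 then b 0 j else t`_j / c 0 j)).
  apply/rowP => j; rewrite 2!mxE; case: eqP => [_|/eqP cj].
    by rewrite -bE mxE.
  exact: coset_mul_eqE cj (tE j).
rewrite -[RHS]t0 (big_nth 0) big_mkord st; apply: eq_bigr => j _.
rewrite mxE; case: eqP => [cj|/eqP cj]; last by rewrite divfK.
(* The zero coset contains only 0, so the term of [t] is 0 here as well. *)
rewrite cj mulr0; apply/esym/(coset_eq0 H); rewrite tE cj; exact: coset_mul0.
Qed.

(** [kermx] is a left kernel, so the rank-nullity count is applied to the transpose. *)
Lemma rank_lt_kernel (B : 'M[K]_(m, n)) :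
  (\rank B < n)%N <-> exists2 c : 'rV[K]_n, c != 0 & B *m c^T = 0.
Proof.
have -> : (\rank B < n)%N = (kermx B^T != 0).
  by rewrite -mxrank_eq0 mxrank_ker mxrank_tr subn_eq0 -ltnNge.
split=> [/rowV0Pn[c /sub_kermxP cB c0]|[c c0 cB]].
  by exists c => //; rewrite -[B]trmxK -trmx_mul cB trmx0.
apply/rowV0Pn; exists c => //; apply/sub_kermxP.
by rewrite -[c]trmxK -trmx_mul cB trmx0.
Qed.

Lemma vsupp_field_neq0 (c : 'rV[K]_n) :
  (vsupp (c : 'rV[field_tract K]_n) != set0) = (c != 0).
Proof.
by apply/set0Pn/rV0Pn => -[i]; rewrite ?inE => ci; exists i; rewrite ?inE.
Qed.

Lemma r_liftP (A : 'M[F]_(m, n)) :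
  r_lift A = n <->
  ~ exists2 c : 'rV[field_tract K]_n,
      vsupp c != set0 & in_kernel A (map_mx (quotient_map H) c).
Proof.
rewrite /r_lift least_eqP; last by move=> _ [A' <- _]; apply: rank_leq_col.
apply: not_iff_compat; split=> [[k kn [A' rA' A'A]]|[c c0 cA]].
  have [|c c0 cA'] := (rank_lt_kernel A').1; first by rewrite rA'.
  exists c => [|i]; first by rewrite vsupp_field_neq0.
  (* The terms of the vanishing product of row [i] of [A'] with [c] are the representatives that
     witness the null sum. *)
  exists [seq c 0 j * A' i j | j : 'I_n].
    rewrite -map_comp; apply: eq_map => j /=.
    by rewrite !mxE -A'A mxE /= coset_mulE.
  have /matrixP/(_ i 0) := cA'; rewrite !mxE big_map enumT => {2}<-.
  by apply: eq_bigr => j _; rewrite mxE mulrC.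
(* The field vector [c] is the same for all rows, so rows lifted independently still form a matrix
   that kills [c]. *)
have lift i : {a' : 'rV[K]_n | map_mx (quotient_map H) a' = row i A &
    \sum_j a' 0 j * c 0 j = 0} by apply/cid2/lift_row/cA.
pose A' : 'M[K]_(m, n) := \matrix_i s2val (lift i).
exists (\rank A'); last first.
  exists A' => //; apply/row_matrixP => i.
  by rewrite -(s2valP (lift i)) -map_row rowK.
apply/rank_lt_kernel; exists c; first by rewrite -vsupp_field_neq0.
apply/matrixP => i j; rewrite !mxE -[RHS](s2valP' (lift i)).
by apply: eq_bigr => k _; rewrite !mxE ord1.
Qed.

(** Every vector over the hyperfield is the image of a vector over [K], and the quotient map
    preserves supports. *)
Lemma kernel_lift (A : 'M[F]_(m, n)) :
  (exists2 c, vsupp c != set0 & in_kernel A c) <->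
  exists2 c : 'rV[field_tract K]_n,
    vsupp c != set0 & in_kernel A (map_mx (quotient_map H) c).
Proof.
split=> [[c c0 cA]|[c c0 cA]].
  have [c' c'E] := quotient_map_surj c.
  exists c'; last by rewrite c'E.
  by rewrite -(vsupp_thom (quotient_map H)) c'E.
by exists (map_mx (quotient_map H) c); rewrite ?vsupp_thom.
Qed.

End Lifts.

Local Close Scope ring_scope.

Theorem theorem4p15 (K : fieldType) (H : unit_subgroup K) (m n : nat)
    (A : 'M[quotient_hyperfield H]_(m, n)) (hmn : n <= m) :
  [<-> r_lift A = n;
       r_hom_mat (quotient_map H) A = n;
       r_col A = n;
       r_mat A = n].
Proof.
(* [r_lift] and [r_hom_mat] are governed by kernel vectors coming from [K], [r_col] and [r_mat] by
   those over the hyperfield; [kernel_lift] links the two kinds. *)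
tfae.
- by move/r_liftP => h; apply/r_hom_matP.
- by move/r_hom_matP => h; apply/r_colP; move/kernel_lift.
- by move/r_colP => h; apply/r_matP.
- by move/r_matP => h; apply/r_liftP; move/kernel_lift.
Qed.
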